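(* If $m$ and $e$ are integers such that $m\geq e\geq 2$, then $F(m,e)=\min\{F(S)\mid S\in\mathcal{C}(m,e)\}$.
   Context: $\mathbb{N}$ denotes the set of non-negative integers. A numerical semigroup is a subset $S\subseteq\mathbb{N}$ closed under addition, with $0\in S$ and $\mathbb{N}\setminus S$ finite. $msg(S)$ is the (unique, finite) minimal system of generators of $S$ and the embedding dimension $e(S)$ is its cardinality. The multiplicity $m(S)$ is the least positive integer belonging to $S$; the Frobenius number $F(S)$ is the greatest integer not belonging to $S$. $\mathcal{L}(m,e)$ is the set of all numerical semigroups $S$ with $m(S)=m$ and $e(S)=e$, and $F(m,e)=\min\{F(S)\mid S\in\mathcal{L}(m,e)\}$. A numerical semigroup $S$ is packed if $msg(S)\subseteq\{m(S),m(S)+1,\ldots,2m(S)-1\}$; $\mathcal{C}(m,e)$ is the set of all packed numerical semigroups with multiplicity $m$ and embedding dimension $e$. *)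

(* Defs.v *)
From mathcomp Require Import all_boot all_order all_algebra finmap.
From mathcomp Require Import all_classical.

Set Implicit Arguments.
Unset Strict Implicit.
Unset Printing Implicit Defensive.

Local Open Scope classical_set_scope.

Section Extrema.
Context {d : Order.disp_t} {T : porderType d}.

Definition is_min (A : set T) (x : T) : Prop := A x /\ lbound A x.
Definition is_max (A : set T) (x : T) : Prop := A x /\ ubound A x.

(* Total versions: the default [x0] is only returned when [A] has no
   least (resp. greatest) element. *)
Definition minimum (x0 : T) (A : set T) : T := xget x0 (is_min A).
Definition maximum (x0 : T) (A : set T) : T := xget x0 (is_max A).

End Extrema.

Definition numerical_semigroup (S : set nat) : Prop :=
  [/\ S 0, (forall x y, S x -> S y -> S (x + y)) & finite_set (~` S)].

(* All finite sums, the empty one included, of elements of [A] (with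
   repetitions): the submonoid of nat generated by [A]. *)
Definition generated (A : set nat) : set nat :=
  [set n | exists2 s : seq nat, [set` s] `<=` A & n = \sum_(x <- s) x].

Definition minimal_generators (S A : set nat) : Prop :=
  generated A = S /\ forall B, B `<` A -> generated B <> S.

(* A numerical semigroup has exactly one minimal system of generators, and it
   is finite, so the default values of [get] and [fset_set] play no role. *)
Definition msg (S : set nat) : set nat := get (minimal_generators S).

Definition embdim (S : set nat) : nat := #|` fset_set (msg S)|.

Definition multiplicity (S : set nat) : nat :=
  minimum 0 [set n | S n /\ 0 < n].

(* The greatest integer outside [S]; it is an [int] because it equals -1 when
   [S] is the whole of nat. *)
Definition frobenius (S : set nat) : int := maximum 0%R (~` (Posz @` S)).

Definition semigroups (m e : nat) : set (set nat) :=
  [set S | [/\ numerical_semigroup S, multiplicity S = m & embdim S = e]].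

Definition packed (S : set nat) : Prop :=
  msg S `<=` [set n | multiplicity S <= n <= 2 * multiplicity S - 1].

Definition packed_semigroups (m e : nat) : set (set nat) :=
  [set S | [/\ numerical_semigroup S, packed S,
               multiplicity S = m & embdim S = e]].

Definition min_frobenius (m e : nat) : int :=
  minimum 0%R (frobenius @` semigroups m e).

(* Main.v *)
Require Import Defs.
From mathcomp Require Import all_boot all_order all_algebra.
From mathcomp Require Import all_classical.
From mathcomp Require Import zify.

(** Every numerical semigroup [S] of multiplicity [m] sits inside a packed one
with the same multiplicity and embedding dimension; since enlarging a numerical
semigroup can only lower its Frobenius number, the minimum over all semigroups
is already attained on packed ones.

The packed semigroup comes from [reduce m], which sends a generator [x] to the
representative of its residue class modulo [m] in the interval [m, 2m - 1].
- Minimal generators of [S] are its atoms (lemma [msgE]), the nonzero elements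
  that are not sums of two nonzero elements.  Two atoms congruent modulo [m]
  would differ by a multiple of [m], an element of [S], so they are equal: the
  reduction is injective on atoms, and preserves their number.
- A sum of two nonzero elements of a monoid generated inside [m, 2m - 1] is at
  least [2m], so any such generating set consists of atoms (lemma
  [atoms_generated]); the reduced atoms thus minimally generate a packed
  semigroup.
- A nonzero element of [S] is at least [m], so an atom is its reduction plus a
  multiple of [m]: the new semigroup contains [S] (lemma [packed_above]).

The minimum over packed semigroups exists because Frobenius numbers are at
least -1 and because the monoid generated by [m, m + 1, ..., m + e - 1] is
packed, with multiplicity [m] and embedding dimension [e] when
[2 <= e <= m]. *)

Local Open Scope classical_set_scope.

(** * Extrema *)

Section ExtremaTheory.
Context {d : Order.disp_t} {T : porderType d}.
Implicit Types (A B : set T) (x : T).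

Lemma minimum_eq x0 A x : is_min A x -> minimum x0 A = x.
Proof.
move=> [Ax lAx]; apply: xget_unique => // y [Ay lAy].
by apply/Order.POrderTheory.le_anti/andP; split; [exact: lAy|exact: lAx].
Qed.

Lemma minimumP x0 A : (exists x, is_min A x) -> is_min A (minimum x0 A).
Proof. exact: xgetPex. Qed.

Lemma maximumP x0 A : (exists x, is_max A x) -> is_max A (maximum x0 A).
Proof. exact: xgetPex. Qed.

Lemma is_min_cofinal A B x : B `<=` A ->
    (forall a, A a -> exists2 b, B b & (b <= a)%O) ->
  is_min B x -> is_min A x.
Proof.
move=> BA AB [Bx lBx]; split=> [|a /AB[b Bb]]; first exact: BA.
exact/Order.POrderTheory.le_trans/lBx.
Qed.

End ExtremaTheory.

Lemma nat_has_min (A : set nat) n : A n -> exists x, is_min A x.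
Proof.
move=> An; have exA : exists n, `[< A n >] by exists n; apply/asboolP.
exists (ex_minn exA); case: ex_minnP => k /asboolP Ak mink.
by split=> // a Aa; apply: mink; apply/asboolP.
Qed.

Lemma int_has_min (A : set int) (b a : int) :
  lbound A b -> A a -> exists x, is_min A x.
Proof.
move=> lAb Aa; have ba : (b <= a)%R by exact: lAb.
have [|k [Ak mink]] := @nat_has_min [set n | A (b + Posz n)%R] `|a - b|%N.
  by rewrite /= (_ : (b + _)%R = a) //; lia.
exists (b + Posz k)%R; split=> // c Ac; have bc : (b <= c)%R by exact: lAb.
have := mink `|c - b|%N; rewrite /= (_ : (b + Posz `|c - b|%N)%R = c); last lia.
by move=> /(_ Ac); rewrite Order.NatOrder.leEnat; lia.
Qed.

Lemma int_has_max (A : set int) (b a : int) :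
  ubound A b -> A a -> exists x, is_max A x.
Proof.
move=> uAb Aa.
have [c Ac||k [Ak mink]] := @int_has_min [set n | A (- n)%R] (- b)%R (- a)%R.
- by have := uAb _ Ac; lia.
- by rewrite /= GRing.opprK.
exists (- k)%R; split=> // c Ac.
by have := mink (- c)%R; rewrite /= GRing.opprK => /(_ Ac); lia.
Qed.

(** * Submonoids of the natural numbers and their atoms *)

Definition submonoid (S : set nat) : Prop :=
  S 0 /\ forall x y, S x -> S y -> S (x + y).

Lemma submonoid_mull {S x} k : submonoid S -> S x -> S (k * x).
Proof.
by move=> [S0 SD] Sx; elim: k => // k IHk; rewrite mulSn; apply: SD.
Qed.

Lemma generated_submonoid (A : set nat) : submonoid (generated A).
Proof.
split=> [|_ _ [s As ->] [t At ->]]; first by exists [::]; rewrite ?big_nil.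
exists (s ++ t); last by rewrite big_cat.
by move=> x /=; rewrite mem_cat => /orP[/As|/At].
Qed.

Lemma sub_generated (A : set nat) : A `<=` generated A.
Proof.
move=> x Ax; exists [:: x]; last by rewrite big_seq1.
by move=> y /=; rewrite inE => /eqP->.
Qed.

Lemma generated_min {A S : set nat} :
  submonoid S -> A `<=` S -> generated A `<=` S.
Proof.
move=> [S0 SD] AS _ [s + ->]; elim: s => [|a s IHs] As; first by rewrite big_nil.
rewrite big_cons; apply: SD; first by apply/AS/As; rewrite /= inE eqxx.
by apply: IHs => x xs; apply: As; rewrite /= inE [x \in s]xs orbT.
Qed.

Definition atoms (S : set nat) : set nat :=
  [set x | [/\ S x, 0 < x &
    forall a b, S a -> S b -> x = a + b -> a = 0 \/ b = 0]].

Lemma atoms_sub (S : set nat) : atoms S `<=` S.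
Proof. by move=> x []. Qed.

(** By strong induction: an element that is neither 0 nor an atom splits into two
strictly smaller elements. *)
Lemma generated_atoms {S : set nat} : submonoid S -> generated (atoms S) = S.
Proof.
move=> Smon; apply/seteqP; split; first exact: generated_min (@atoms_sub S).
have [G0 GD] := generated_submonoid (atoms S).
elim/ltn_ind => x IHx Sx.
have [->//|x_gt0] := posnP x.
have [xatom|/not_and3P xNatom] := pselect (atoms S x); first exact: sub_generated.
have [//|//|] := xNatom.
move=> /existsNP[a /existsNP[b]].
move=> /not_implyP[Sa] /not_implyP[Sb] /not_implyP[xE] /not_orP[a0 b0].
by rewrite xE; apply: GD; apply: IHx => //; lia.
Qed.

(** When an atom is written as a sum of generators, all but one of the terms
vanish. *)
Lemma atoms_generatedS (A : set nat) : atoms (generated A) `<=` A.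
Proof.
have [G0 GD] := generated_submonoid A.
move=> x xatom; case: (xatom) => -[s + xE] x_gt0 _.
elim: s xE => [|a s IHs]; rewrite ?big_nil ?big_cons => xE As; first by lia.
have Aa : A a by apply: As; rewrite /= inE eqxx.
have {}As : [set` s] `<=` A by move=> y ys; apply: As; rewrite /= inE [y \in s]ys orbT.
have [_ _ /(_ _ _ _ _ xE)] := xatom.
case=> [||a0|s0]; [exact: sub_generated|by exists s| |].
- by apply: IHs => //; rewrite xE a0.
- by rewrite xE s0 addn0.
Qed.

(** The atoms generate [S] and lie in every generating set, so they are the only
minimal one. *)
Lemma msgE {S : set nat} : submonoid S -> msg S = atoms S.
Proof.
move=> Smon; apply: get_unique => [|A [GA minA]].
  split=> [|B [BS nSB] GB]; first exact: generated_atoms.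
  by apply: nSB; rewrite -GB; exact: atoms_generatedS.
have sSA : atoms S `<=` A by rewrite -GA; exact: atoms_generatedS.
apply/seteqP; split=> //; apply: contrapT => nAS.
by apply: (minA (atoms S)); [split|exact: generated_atoms].
Qed.

(** * Multiplicity and packed generating sets *)

Section Packed.
Variables (m : nat) (A : set nat).
Hypotheses (m_gt0 : 0 < m) (Am : A m).
Hypothesis A_itv : A `<=` [set n | m <= n <= 2 * m - 1].

Lemma generated_ge n : generated A n -> 0 < n -> m <= n.
Proof.
have mon : submonoid [set n | n = 0 \/ m <= n] by split=> [|x y] /=; lia.
move=> /(generated_min mon)[a /A_itv /= /andP[]||] //; [by right|by move=> ->].
Qed.

Lemma atoms_generated : atoms (generated A) = A.
Proof.
apply/seteqP; split=> [|x Ax]; first exact: atoms_generatedS.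
have /= /andP[mx xm] := A_itv _ Ax.
split=> [||a b Ga Gb xE]; [exact: sub_generated|lia|].
by have := generated_ge _ Ga; have := generated_ge _ Gb; lia.
Qed.

Lemma multiplicity_generated : multiplicity (generated A) = m.
Proof.
apply: minimum_eq; split=> [|n [Gn n0]]; last exact: generated_ge.
by split=> //; exact: sub_generated.
Qed.

Lemma packed_generated e : numerical_semigroup (generated A) ->
  (A #= `I_e)%card -> packed_semigroups m e (generated A).
Proof.
move=> nsG Ae; have mE := multiplicity_generated.
have msgA : msg (generated A) = A.
  by rewrite msgE ?atoms_generated//; exact: generated_submonoid.
split=> //; first by rewrite /packed msgA mE.
by rewrite /embdim msgA; exact: card_fset_set.
Qed.

End Packed.

(** * Numerical semigroups *)

Lemma numerical_submonoid {S} : numerical_semigroup S -> submonoid S.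
Proof. by case. Qed.

Lemma cofinite_natP (S : set nat) :
  finite_set (~` S) <-> exists N, forall n, N <= n -> S n.
Proof.
split=> [/finite_seqP[s sE]|[N SN]].
  exists (\max_(i <- s) i).+1 => n ltn; apply: contrapT => nSn.
  have : [set` s] n by rewrite -sE.
  by move=> /= ns; have := leq_bigmax_seq n (F := id) ns isT; lia.
apply: (@sub_finite_set _ _ `I_N); last exact: finite_II.
by move=> n nSn /=; rewrite ltnNge; apply/negP => /SN.
Qed.

Lemma numerical_sub {S T : set nat} :
  submonoid T -> S `<=` T -> numerical_semigroup S -> numerical_semigroup T.
Proof.
move=> [T0 TD] ST [_ _ cS]; split=> //.
exact: sub_finite_set (subsetC ST) cS.
Qed.

Lemma multiplicityP {S} : numerical_semigroup S ->
  is_min [set n | S n /\ 0 < n] (multiplicity S).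
Proof.
move=> [_ _ /cofinite_natP[N SN]]; apply: minimumP.
by apply: (@nat_has_min _ N.+1); split=> //; exact: SN.
Qed.

Lemma frobeniusP {S} : numerical_semigroup S ->
  is_max (~` (Posz @` S)) (frobenius S).
Proof.
move=> [_ _ /cofinite_natP[N SN]]; apply: maximumP.
apply: (@int_has_max _ (Posz N) (- 1)%R) => [x nSx|[n _]]; last by lia.
have [//|ltNx] := Order.TotalTheory.leP x (Posz N).
by case: nSx; exists `|x|%N; [apply: SN; lia|lia].
Qed.

Lemma frobenius_ge {S} : numerical_semigroup S -> (- 1 <= frobenius S)%R.
Proof. by move=> /frobeniusP[_]; apply=> -[n _]; lia. Qed.

Lemma frobenius_anti {S T : set nat} :
    numerical_semigroup S -> numerical_semigroup T -> S `<=` T ->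
  (frobenius T <= frobenius S)%R.
Proof.
move=> /frobeniusP[_ maxS] /frobeniusP[nT _] ST; apply: maxS.
by apply: subsetC nT; exact: image_subset.
Qed.

(** * Reduction of the generators modulo the multiplicity *)

Definition reduce (m x : nat) : nat := m + x %% m.

Section Reduce.
Variables (S : set nat).
Hypothesis nsS : numerical_semigroup S.
Let m := multiplicity S.

Let m_gt0 : 0 < m. Proof. by have [[]] := multiplicityP nsS. Qed.
Let Sm : S m. Proof. by have [[]] := multiplicityP nsS. Qed.
Let m_min x : S x -> 0 < x -> m <= x.
Proof. by move=> Sx x0; have [_] := multiplicityP nsS; apply. Qed.

(** A sum of two nonzero elements is at least twice the multiplicity. *)
Lemma multiplicity_atom : atoms S m.
Proof.
split=> // a b Sa Sb mE.
by have := m_min _ Sa; have := m_min _ Sb; lia.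
Qed.

(** Otherwise [y] would be the sum of [x] and a positive multiple of [m]. *)
Lemma atoms_modn_le x y :
  atoms S x -> atoms S y -> x = y %[mod m] -> x <= y -> x = y.
Proof.
move=> [Sx x_gt0 _] [_ _ yirr] /eqP; rewrite eq_sym => xy lexy.
have /dvdnP[k kE] : m %| y - x by rewrite -eqn_mod_dvd.
have Sk : S (y - x) by rewrite kE; exact: submonoid_mull (numerical_submonoid nsS) Sm.
have [||||] := yirr x (y - x) => //; lia.
Qed.

Lemma atoms_modn_inj : {in atoms S &, injective (fun x => x %% m)}.
Proof.
move=> x y /set_mem xS /set_mem yS xy; have [lexy|/ltnW leyx] := leqP x y.
  exact: atoms_modn_le.
by apply/esym/atoms_modn_le.
Qed.

Lemma finite_atoms : finite_set (atoms S).
Proof.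
rewrite -(eq_finite_set (inj_card_eq atoms_modn_inj)).
apply: (@sub_finite_set _ _ `I_m); last exact: finite_II.
by move=> _ [x _ <-] /=; rewrite ltn_mod.
Qed.

Lemma card_atoms : (atoms S #= `I_(embdim S))%card.
Proof.
have /finite_setP[n Sn] := finite_atoms.
by rewrite /embdim (msgE (numerical_submonoid nsS)) (card_fset_set Sn).
Qed.

Let A := reduce m @` atoms S.

(** An atom [x] is at least [m], hence at least its reduction; the difference is
a multiple of [m], which is itself a reduced atom. *)
Lemma sub_generated_reduce : S `<=` generated A.
Proof.
have Gmon := generated_submonoid A.
have Am : A m by exists m; [exact: multiplicity_atom|rewrite /reduce modnn addn0].
rewrite -{1}(generated_atoms (numerical_submonoid nsS)).
apply: generated_min => // x xS; have [Sx x0 _] := xS.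
have lemx := m_min _ Sx x0.
have -> : x = reduce m x + (x %/ m).-1 * m.
  rewrite /reduce {1}(divn_eq x m).
  have : 0 < x %/ m by rewrite divn_gt0.
  by case: (x %/ m) => // k _; rewrite mulSn /=; lia.
apply: Gmon.2; first by apply: sub_generated; exists x.
by apply: submonoid_mull Gmon _; exact: sub_generated.
Qed.

Lemma packed_above :
  exists2 T, packed_semigroups m (embdim S) T & S `<=` T.
Proof.
exists (generated A); last exact: sub_generated_reduce.
apply: packed_generated => //.
- by exists m; [exact: multiplicity_atom|rewrite /reduce modnn addn0].
- by move=> _ [x _ <-] /=; have := ltn_pmod x m_gt0; rewrite /reduce; lia.
- exact: numerical_sub (generated_submonoid A) sub_generated_reduce nsS.
apply: card_eq_trans card_atoms; apply: inj_card_eq => x y xS yS.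
by move=> /addnI; exact: atoms_modn_inj.
Qed.

End Reduce.

(** * Existence of packed semigroups *)

Lemma packed_semigroups_neq0 m e : 2 <= e <= m ->
  exists S, packed_semigroups m e S.
Proof.
move=> /andP[e2 em]; pose A := addn m @` `I_e; exists (generated A).
have Gmon := generated_submonoid A.
have Am : A m by exists 0; rewrite ?addn0//=; lia.
have AmS : A m.+1 by exists 1; rewrite ?addn1.
apply: packed_generated => //.
- lia.
- by move=> _ [i /= ie <-]; lia.
- split; [exact: Gmon.1|exact: Gmon.2|apply/cofinite_natP].
  (* From [m * m] on, the quotient by [m] exceeds the remainder [r], so [r] of
     the copies of [m] can be replaced by [m + 1]. *)
  exists (m * m) => n lemn.
  have ltr : n %% m < m by rewrite ltn_mod; lia.
  have leq : m <= n %/ m by rewrite leq_divRL; lia.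
  have -> : n = n %% m * m.+1 + (n %/ m - n %% m) * m.
    by rewrite {1}(divn_eq n m) mulnS mulnBl; nia.
  by apply: Gmon.2; apply: submonoid_mull Gmon _; exact: sub_generated.
by apply: inj_card_eq => x y _ _; exact: addnI.
Qed.

Theorem corollary25 (m e : nat) (he : 2 <= e) (hem : e <= m) :
  [/\ is_min (frobenius @` semigroups m e) (min_frobenius m e),
      is_min (frobenius @` packed_semigroups m e)
        (minimum 0%R (frobenius @` packed_semigroups m e)) &
      min_frobenius m e = minimum 0%R (frobenius @` packed_semigroups m e)].
Proof.
have [S0 packS0] : exists S, packed_semigroups m e S.
  by apply: packed_semigroups_neq0; rewrite he.
have minP : is_min (frobenius @` packed_semigroups m e)
    (minimum 0%R (frobenius @` packed_semigroups m e)).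
  apply/minimumP/(@int_has_min _ (- 1)%R (frobenius S0)); last by exists S0.
  by move=> _ [S [nsS _ _ _] <-]; exact: frobenius_ge.
have minL : is_min (frobenius @` semigroups m e)
    (minimum 0%R (frobenius @` packed_semigroups m e)).
  apply: is_min_cofinal minP; first by apply: image_subset => S [].
  move=> _ [S [nsS <- <-] <-]; have [T packT ST] := packed_above _ nsS.
  exists (frobenius T); first by exists T.
  by have [nsT _ _ _] := packT; exact: frobenius_anti.
have minE : min_frobenius m e = minimum 0%R (frobenius @` packed_semigroups m e).
  exact: minimum_eq.
by rewrite minE.
Qed.
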